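(* Assume $r_k\ge4/7$ for all $k\ge2$, $\kappa\ge\|f'\|_{C[-\beta,\beta]}$, $\|\phi^0\|_\infty\le\beta$, and $$\tau_1\le\min\Big\{\Big(\frac{4}{11\varsigma m(\kappa+4\varepsilon^2/h^2)\Gamma(2-\alpha)}\Big)^{1/\alpha},\Big(\frac{4}{11\kappa(1-\varsigma)m\Gamma(2-\alpha)}\Big)^{1/\alpha}\Big\}.$$ If moreover for all $n\ge1$ $$\tau_n\le\Big(\frac{4}{11(1-\varsigma)m(4\varepsilon^2/h^2+\kappa K_2)\Gamma(2-\alpha)}\Big)^{1/\alpha},$$ then the solution of the (balanced) $L2$-$1_\sigma$-sESAV scheme satisfies $\|\phi^n\|_\infty\le\beta$ for all $n\ge1$.
   Context: Setting: $\Omega=(0,L)^2$ with periodic boundary conditions; constants $m>0$, $\varepsilon>0$, $\alpha\in(0,1)$, and $\varsigma:=\alpha/2$. The nonlinearity $f=-F'$ is one of: (double-well) $F(\phi)=\frac14(1-\phi^2)^2$, $f(\phi)=\phi-\phi^3$, with $\beta=1$; or (Flory–Huggins) $F(\phi)=\frac{\theta}{2}[(1+\phi)\ln(1+\phi)+(1-\phi)\ln(1-\phi)]-\frac{\theta_c}{2}\phi^2$, $f(\phi)=\frac{\theta}{2}\ln\frac{1-\phi}{1+\phi}+\theta_c\phi$ on $(-1,1)$, with $\theta_c>\theta>0$ and $\beta\in(0,1)$ the positive root of $f$. In both cases $f(\pm\beta)=0$. Spatial discretization: $M\in\mathbb N$, $h=L/M$; $\mathbb V_h$ is the space of real grid functions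 $v=\{v_{ij}\}_{i,j\in\mathbb Z}$ that are $M$-periodic in each index; $\langle v,w\rangle=h^2\sum_{i,j=1}^Mv_{ij}w_{ij}$, $\|v\|_\infty=\max_{1\le i,j\le M}|v_{ij}|$; $\Delta_hv_{ij}=h^{-2}(v_{i+1,j}+v_{i-1,j}+v_{i,j+1}+v_{i,j-1}-4v_{ij})$. Scalar functions act on grid functions pointwise. $E_{1h}[v]=\langle F(v),1\rangle$ and $g_h(v,w)=\exp(w)/\exp(E_{1h}[v])$ for $v\in\mathbb V_h$ (with $\|v\|_\infty<1$ in the Flory–Huggins case) and $w\in\mathbb R$. Auxiliary functional: $V:\mathbb R\to\mathbb R$ satisfies (A1) $V\in C^1(\mathbb R)\cap W^{2,\infty}(\mathbb R)$, $V(1)=1$, $V'(1)=0$, $|V'|\le K_1$; (A2) $0\le V\le K_2$ for a constant $K_2>0$; (A3) $|z_1-1|\le|z_2-1|$ implies $|V(z_1)-1|\le|V(z_2)-1|$. Time grid: $0=t_0<t_1<\dots<t_N=T$, $\tau_k=t_k-t_{k-1}$, $r_k=\tau_k/\tau_{k-1}$ ($k\ge2$), $\nabla_\tau v^k=v^k-v^{k-1}$, $\mathbb D_\tau v^k=\nabla_\tau v^k/\tau_k$, $\omega_\mu(t)=t^{\mu-1}/\Gamma(\mu)$. Constant $\kappa\ge0$; data $\phi^0\in\mathbb V_h$, $R^0\in\mathbb R$. For $n\ge2$ the predicted solution is $\hat\phi^n=\min\{\max\{(1+r_n)\phi^{n-1}-r_n\phi^{n-2},-\beta\},\beta\}$ (pointwise).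 $L2$-$1_\sigma$ discretization: $t_{k-\varsigma}=(1-\varsigma)t_k+\varsigma t_{k-1}$, $t_{k-1/2}=(t_k+t_{k-1})/2$; $a^{(n)}_{n-k}=\frac1{\tau_k}\int_{t_{k-1}}^{\min\{t_k,t_{n-\varsigma}\}}\omega_{1-\alpha}(t_{n-\varsigma}-s)\,ds$ ($1\le k\le n$), $b^{(n)}_{n-k}=\frac{2}{\tau_k(\tau_k+\tau_{k+1})}\int_{t_{k-1}}^{t_k}(s-t_{k-1/2})\omega_{1-\alpha}(t_{n-\varsigma}-s)\,ds$ ($1\le k\le n-1$); $B^{(1)}_0=a^{(1)}_0$, and for $n\ge2$: $B^{(n)}_0=a^{(n)}_0+b^{(n)}_1/r_n$, $B^{(n)}_{n-k}=a^{(n)}_{n-k}+b^{(n)}_{n-k+1}/r_k-b^{(n)}_{n-k}$ for $2\le k\le n-1$, $B^{(n)}_{n-1}=a^{(n)}_{n-1}-b^{(n)}_{n-1}$; $\tilde{\mathbb D}^\alpha_\tau v^n=\sum_{k=1}^nB^{(n)}_{n-k}\nabla_\tau v^k$; $w^{k-\varsigma}=(1-\varsigma)w^k+\varsigma w^{k-1}$. Balanced $L2$-$1_\sigma$-sESAV scheme: $\hat\phi^1\in\mathbb V_h$ with $\|\hat\phi^1\|_\infty\le\beta$ solves $B^{(1)}_0(\hat\phi^1-\phi^0)=m(\varepsilon^2\Delta_h\hat\phi^{1-\varsigma}+f(\hat\phi^{1-\varsigma}))$; for $n\ge2$, $\hat\phi^n$ is the predicted solution above. For $n\ge1$ set $\hat\phi^{n-\varsigma}=(1-\varsigma)\hat\phi^n+\varsigma\phi^{n-1}$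 and $V^{n-\varsigma}=V(g_h(\hat\phi^{n-\varsigma},R^{n-1}))$, and define $(\phi^n,R^n)$ by $\tilde{\mathbb D}^\alpha_\tau\phi^n=m(\varepsilon^2\Delta_h\phi^{n-\varsigma}+V^{n-\varsigma}f(\hat\phi^{n-\varsigma})-\kappa V^{n-\varsigma}(\phi^{n-\varsigma}-\hat\phi^{n-\varsigma}))$ and $\mathbb D_\tau R^n=V^{n-\varsigma}\langle-f(\hat\phi^{n-\varsigma})+\kappa(\phi^{n-\varsigma}-\hat\phi^{n-\varsigma}),\mathbb D_\tau\phi^n\rangle$. *)

(* Defs.v *)
From Stdlib Require Import Reals Lra ZArith List.
From Coquelicot Require Import Coquelicot.
Open Scope R_scope.

Definition Gamma (x : R) : R :=
  RInt_gen (fun t => Rpower t (x - 1) * exp (- t)) (at_right 0) (Rbar_locally p_infty).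

(* omega_mu(t) = t^(mu-1)/Gamma(mu)  (used for t > 0) *)
Definition omega (mu t : R) : R := Rpower t (mu - 1) / Gamma mu.

Definition integ (f : R -> R) (a b : R) : R := RInt_gen f (at_right a) (at_left b).

Definition grid := Z -> Z -> R.

Definition in_Vh (M : nat) (v : grid) : Prop :=
  forall i j : Z, v (i + Z.of_nat M)%Z j = v i j /\ v i (j + Z.of_nat M)%Z = v i j.

Definition idx (M : nat) : list Z := map Z.of_nat (seq 1 M).

Definition grid_sum (M : nat) (v : grid) : R :=
  fold_right Rplus 0 (map (fun i => fold_right Rplus 0 (map (fun j => v i j) (idx M))) (idx M)).

Definition ip (M : nat) (h : R) (v w : grid) : R := h ^ 2 * grid_sum M (fun i j => v i j * w i j).

Definition norm_inf (M : nat) (v : grid) : R :=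
  fold_right Rmax 0 (map (fun i => fold_right Rmax 0 (map (fun j => Rabs (v i j)) (idx M))) (idx M)).

Definition lap (h : R) (v : grid) : grid := fun i j =>
  / h ^ 2 * (v (i + 1)%Z j + v (i - 1)%Z j + v i (j + 1)%Z + v i (j - 1)%Z - 4 * v i j).

Definition gmap (g : R -> R) (v : grid) : grid := fun i j => g (v i j).
Definition gcomb (a : R) (v : grid) (b : R) (w : grid) : grid := fun i j => a * v i j + b * w i j.

Inductive nonlin := DoubleWell | FloryHuggins (theta thetac : R).

Definition Fpot (c : nonlin) (x : R) : R :=
  match c with
  | DoubleWell => / 4 * (1 - x ^ 2) ^ 2
  | FloryHuggins th thc =>
      th / 2 * ((1 + x) * ln (1 + x) + (1 - x) * ln (1 - x)) - thc / 2 * x ^ 2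
  end.

Definition fnl (c : nonlin) (x : R) : R :=
  match c with
  | DoubleWell => x - x ^ 3
  | FloryHuggins th thc => th / 2 * ln ((1 - x) / (1 + x)) + thc * x
  end.

Definition nonlin_ok (c : nonlin) (beta : R) : Prop :=
  match c with
  | DoubleWell => beta = 1
  | FloryHuggins th thc => 0 < th /\ th < thc /\ 0 < beta /\ beta < 1 /\ fnl c beta = 0
  end.

Definition E1h (c : nonlin) (M : nat) (h : R) (v : grid) : R :=
  ip M h (gmap (Fpot c) v) (fun _ _ => 1).
Definition gh (c : nonlin) (M : nat) (h : R) (v : grid) (w : R) : R := exp w / exp (E1h c M h v).

Definition hypA1 (V : R -> R) (K1 : R) : Prop :=
  (forall x, ex_derive V x) /\ (forall x, continuous (Derive V) x) /\
  (exists C, forall x, Rabs (V x) <= C) /\                                (* W^{2,oo}: V bounded, *)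
  (exists C, forall x, Rabs (Derive V x) <= C) /\
  (exists Lip, forall x y, Rabs (Derive V x - Derive V y) <= Lip * Rabs (x - y)) /\ (* V'' bounded *)
  V 1 = 1 /\ Derive V 1 = 0 /\ (forall x, Rabs (Derive V x) <= K1).
Definition hypA2 (V : R -> R) (K2 : R) : Prop := 0 < K2 /\ forall x, 0 <= V x <= K2.
Definition hypA3 (V : R -> R) : Prop :=
  forall z1 z2, Rabs (z1 - 1) <= Rabs (z2 - 1) -> Rabs (V z1 - 1) <= Rabs (V z2 - 1).

Definition tau (t : nat -> R) (k : nat) : R := t k - t (k - 1)%nat.
Definition ratio (t : nat -> R) (k : nat) : R := tau t k / tau t (k - 1)%nat.

Section L21sigma.
Variables (alpha : R) (t : nat -> R).
Let vs := alpha / 2.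
Definition tsig (n : nat) : R := (1 - vs) * t n + vs * t (n - 1)%nat.
(* acoef n k = a^{(n)}_{n-k},  1 <= k <= n *)
Definition acoef (n k : nat) : R :=
  / tau t k * integ (fun s => omega (1 - alpha) (tsig n - s)) (t (k - 1)%nat) (Rmin (t k) (tsig n)).
(* bcoef n k = b^{(n)}_{n-k},  1 <= k <= n-1 *)
Definition bcoef (n k : nat) : R :=
  2 / (tau t k * (tau t k + tau t (k + 1)%nat)) *
  integ (fun s => (s - (t k + t (k - 1)%nat) / 2) * omega (1 - alpha) (tsig n - s)) (t (k - 1)%nat) (t k).
(* Bcoef n k = B^{(n)}_{n-k},  1 <= k <= n *)
Definition Bcoef (n k : nat) : R :=
  if (n =? 1)%nat then acoef 1 1
  else if (k =? n)%nat then acoef n n + bcoef n (n - 1)%nat / ratio t n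
  else if (k =? 1)%nat then acoef n 1 - bcoef n 1
  else acoef n k + bcoef n (k - 1)%nat / ratio t k - bcoef n k.
End L21sigma.

Definition Dalpha (alpha : R) (t : nat -> R) (v : nat -> grid) (n : nat) : grid := fun i j =>
  fold_right Rplus 0 (map (fun k => Bcoef alpha t n k * (v k i j - v (k - 1)%nat i j)) (seq 1 n)).

Definition clamp (beta x : R) : R := Rmin (Rmax x (- beta)) beta.
Definition phihat (beta : R) (t : nat -> R) (phi : nat -> grid) (phihat1 : grid) (n : nat) : grid :=
  if (n =? 1)%nat then phihat1
  else fun i j => clamp beta ((1 + ratio t n) * phi (n - 1)%nat i j - ratio t n * phi (n - 2)%nat i j).

(* Main.v *)
Require Import Defs.
From Stdlib Require Import ssreflect Reals Lra Lia ZArith List.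
From Coquelicot Require Import Coquelicot.
Open Scope R_scope.
Unset SsrRewrite.

(** Let [g s = omega (1 - alpha) (t_{n-vs} - s)], which is increasing and convex.
  Monotonicity of [g] gives [a_k - b_k >= g (t (k-1))], and convexity together with [r_k >= 4/7]
  gives [a_k + b_{k-1} / r_k <= g (t k)] for [k < n], so the coefficients interlace with the values
  of [g]: [g (t (k-1)) <= B_k <= g (t k)].  With [vs = alpha/2] the last coefficient is at least
  [(1-vs)/(1-alpha) g (t (n-1))], whence a gap [B_n - B_{n-1}] of order [tau_n^(-alpha)], which the
  step size restriction makes at least [vs m (4 eps^2/h^2 + kappa K2)].  The bound then follows by
  induction on [n]: solving the scheme for the new grid function, all history terms have nonnegative
  weights, [|f + kappa x| <= kappa beta] on [[-beta, beta]], and the discrete Laplacian obeys a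
  maximum principle. *)

(** * Improper integrals through primitives *)

Lemma filterlim_Rminus (T : Type) (F : (T -> Prop) -> Prop) {FF : Filter F} (f g : T -> R) (a b : R) :
  filterlim f F (locally a) -> filterlim g F (locally b) ->
  filterlim (fun x => f x - g x) F (locally (a - b)).
Proof.
intros Hf Hg; apply (filterlim_comp_2 (G := locally a) (H := locally (- b)) f (fun x => - g x) Rplus).
- exact Hf.
- exact (filterlim_comp _ _ _ g Ropp _ _ _ Hg (filterlim_opp b)).
- exact (filterlim_plus a (- b)).
Qed.

(** Fundamental theorem of calculus with endpoints taken along filters. At a singular end only a
    limit of the primitive is required, which serves both the Gamma integral and the weakly singular
    kernel. *)
Lemma is_RInt_gen_primitive (F f : R -> R) (Fa Fb : (R -> Prop) -> Prop)
  {FFa : Filter Fa} {FFb : Filter Fb} (la lb : R) :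
  filter_prod Fa Fb (fun ab => forall x, Rmin (fst ab) (snd ab) <= x <= Rmax (fst ab) (snd ab) ->
    is_derive F x (f x) /\ continuous f x) ->
  filterlim F Fa (locally la) -> filterlim F Fb (locally lb) ->
  is_RInt_gen f Fa Fb (lb - la).
Proof.
intros Hd Ha Hb P HP.
assert (Hlim : filterlim (fun ab => F (snd ab) - F (fst ab)) (filter_prod Fa Fb) (locally (lb - la))).
{ apply filterlim_Rminus; [typeclasses eauto | |].
  - apply (filterlim_comp _ _ _ _ _ _ _ _ filterlim_snd Hb).
  - apply (filterlim_comp _ _ _ _ _ _ _ _ filterlim_fst Ha). }
unfold filtermapi.
specialize (Hlim P HP); unfold filtermap in Hlim.
generalize (filter_and _ _ Hd Hlim).
apply filter_imp; intros [a b] [H1 H2].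
exists (minus (F b) (F a)); split; [|exact H2].
apply: is_RInt_derive; intros x Hx; apply H1; exact Hx.
Qed.

Lemma at_right_gt (a b : R) : a < b -> at_right a (fun x => a < x < b).
Proof.
intros Hab. assert (Hp : 0 < b - a) by lra.
exists (mkposreal _ Hp); intros y Hy Hay; split; [exact Hay|].
unfold ball in Hy; cbn in Hy; unfold AbsRing_ball, abs, minus, plus, opp in Hy; cbn in Hy.
apply Rabs_def2 in Hy; lra.
Qed.

Lemma at_left_lt (a b : R) : a < b -> at_left b (fun x => a < x < b).
Proof.
intros Hab. assert (Hp : 0 < b - a) by lra.
exists (mkposreal _ Hp); intros y Hy Hay; split; [|exact Hay].
unfold ball in Hy; cbn in Hy; unfold AbsRing_ball, abs, minus, plus, opp in Hy; cbn in Hy.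
apply Rabs_def2 in Hy; lra.
Qed.

Lemma filterlim_eps (F : (R -> Prop) -> Prop) {FF : Filter F} (f : R -> R) (l : R) :
  (forall e, 0 < e -> F (fun x => Rabs (f x - l) < e)) -> filterlim f F (locally l).
Proof.
intros H; apply filterlim_locally; intros [e He].
exact (H e He).
Qed.

Lemma integ_primitive (F f : R -> R) (a b la lb : R) :
  a < b ->
  (forall x, a < x < b -> is_derive F x (f x) /\ continuous f x) ->
  filterlim F (at_right a) (locally la) -> filterlim F (at_left b) (locally lb) ->
  integ f a b = lb - la.
Proof.
intros Hab Hd Ha Hb; apply is_RInt_gen_unique.
apply (is_RInt_gen_primitive F f (at_right a) (at_left b)); [|exact Ha|exact Hb].
exists (fun x => a < x < b) (fun x => a < x < b);
  [exact (at_right_gt _ _ Hab) | exact (at_left_lt _ _ Hab) |].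
cbn; intros x y Hx Hy z Hz; apply Hd.
unfold Rmin, Rmax in Hz; destruct (Rle_dec x y); lra.
Qed.

(** [T] is the place of a singularity beyond the interval. Up to [T] the function [RInt f a] is a
    primitive that is continuous at both ends, so its one-sided limits are its values. *)
Lemma integ_RInt (f : R -> R) (a b T : R) :
  a < b < T -> (forall x, x < T -> continuous f x) -> integ f a b = RInt f a b.
Proof.
intros [Hab HbT] Hf.
assert (Hd : forall x, x < T -> is_derive (RInt f a) x (f x)).
{ intros x Hx; apply (is_derive_RInt f (RInt f a) a); [|apply Hf; exact Hx].
  apply (locally_interval _ x m_infty T); cbn; try easy.
  intros y _ HyT; apply: RInt_correct; apply: ex_RInt_continuous; intros z Hz.
  apply Hf; unfold Rmax in Hz; destruct (Rle_dec a y); lra. }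
assert (Hc : forall x, x < T -> filterlim (RInt f a) (locally x) (locally (RInt f a x))).
{ intros x Hx; apply: ex_derive_continuous; eexists; apply Hd; exact Hx. }
rewrite (integ_primitive (RInt f a) f a b (RInt f a a) (RInt f a b)).
- rewrite RInt_point; unfold zero; cbn; ring.
- exact Hab.
- intros x Hx; split; [apply Hd | apply Hf]; lra.
- eapply filterlim_filter_le_1; [apply filter_le_within | apply Hc; lra].
- eapply filterlim_filter_le_1; [apply filter_le_within | apply Hc; lra].
Qed.

(** * The Gamma function *)

(** The limits are the infimum and the supremum of [F] on the positive axis. The infimum is obtained
    as minus the supremum of [- F]. *)
Lemma monotone_bounded_limits (F : R -> R) (A B : R) :
  (forall x y, 0 < x <= y -> F x <= F y) -> (forall x, 0 < x -> A <= F x <= B) ->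
  exists la lb, filterlim F (at_right 0) (locally la) /\
    filterlim F (Rbar_locally p_infty) (locally lb) /\ forall x, 0 < x -> la <= F x <= lb.
Proof.
intros Hm Hb.
destruct (completeness (fun y => exists x, 0 < x /\ y = F x)) as [lb [Hlb1 Hlb2]].
{ exists B; intros y (x & Hx & ->); apply Hb; exact Hx. }
{ exists (F 1), 1; split; [lra | reflexivity]. }
destruct (completeness (fun y => exists x, 0 < x /\ y = - F x)) as [la [Hla1 Hla2]].
{ exists (- A); intros y (x & Hx & ->); destruct (Hb x Hx); lra. }
{ exists (- F 1), 1; split; [lra | reflexivity]. }
assert (Hlb : forall x, 0 < x -> F x <= lb) by (intros x Hx; apply Hlb1; exists x; auto).
assert (Hla : forall x, 0 < x -> - la <= F x).
{ intros x Hx; assert (- F x <= la) by (apply Hla1; exists x; auto); lra. }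
exists (- la), lb; split; [|split].
- apply filterlim_eps; [typeclasses eauto|]; intros e He.
  (* Either some value is within [e] of the infimum, and monotonicity keeps all smaller arguments
     there, or [la - e] would be a smaller upper bound of [- F]. *)
  destruct (Classical_Prop.classic (exists x, 0 < x /\ F x < - la + e)) as [(x & Hx & Hxe)|Hn].
  + generalize (at_right_gt 0 x Hx); apply filter_imp; intros y Hy.
    assert (F y <= F x) by (apply Hm; lra).
    assert (- la <= F y) by (apply Hla; lra).
    apply Rabs_def1; lra.
  + exfalso; assert (la <= la - e); [|lra].
    apply Hla2; intros y (x & Hx & ->).
    destruct (Rlt_le_dec (F x) (- la + e)) as [h|h]; [|lra].
    exfalso; apply Hn; exists x; auto.
- apply filterlim_eps; [typeclasses eauto|]; intros e He.
  destruct (Classical_Prop.classic (exists x, 0 < x /\ lb - e < F x)) as [(x & Hx & Hxe)|Hn].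
  + exists x; intros y Hy.
    assert (F x <= F y) by (apply Hm; lra).
    assert (F y <= lb) by (apply Hlb; lra).
    apply Rabs_def1; lra.
  + exfalso; assert (lb <= lb - e); [|lra].
    apply Hlb2; intros y (x & Hx & ->).
    destruct (Rlt_le_dec (lb - e) (F x)) as [h|h]; [|lra].
    exfalso; apply Hn; exists x; auto.
- intros x Hx; auto.
Qed.

Lemma Rpower_pos (x y : R) : 0 < Rpower x y.
Proof. apply exp_pos. Qed.

Lemma is_derive_Rpower (x y : R) : 0 < x -> is_derive (fun z => Rpower z y) x (y * Rpower x (y - 1)).
Proof. intros Hx; apply is_derive_Reals; apply derivable_pt_lim_power; exact Hx. Qed.

Lemma Rpower_pred (x y : R) : 0 < x -> Rpower x y = x * Rpower x (y - 1).
Proof.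
intros Hx; replace y with (1 + (y - 1)) at 1 by ring.
rewrite Rpower_plus, Rpower_1; auto.
Qed.

Lemma filterlim_Rpower_0 (y : R) : 0 < y -> filterlim (fun x => Rpower x y) (at_right 0) (locally 0).
Proof.
intros Hy; apply filterlim_eps; [typeclasses eauto|]; intros e He.
generalize (at_right_gt 0 (Rpower e (/ y)) (Rpower_pos _ _)); apply filter_imp; intros x [Hx0 Hx].
rewrite Rminus_0_r, Rabs_pos_eq by (left; apply Rpower_pos).
replace e with (Rpower (Rpower e (/ y)) y).
- apply Rlt_Rpower_l; lra.
- rewrite Rpower_mult, Rinv_l, Rpower_1; lra.
Qed.

Definition gamma_integrand (x t : R) : R := Rpower t (x - 1) * exp (- t).

Lemma continuous_gamma_integrand (x t : R) : 0 < t -> continuous (gamma_integrand x) t.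
Proof.
intros Ht; apply: ex_derive_continuous; eexists; unfold gamma_integrand.
apply: is_derive_mult; [apply is_derive_Rpower; exact Ht | auto_derive; [exact I|reflexivity] |].
intros; apply Rmult_comm.
Qed.

Lemma is_derive_gamma_primitive (x t : R) :
  0 < t -> is_derive (RInt (gamma_integrand x) 1) t (gamma_integrand x t).
Proof.
intros Ht; apply (is_derive_RInt _ _ 1); [|apply continuous_gamma_integrand; exact Ht].
apply (locally_interval _ t 0 p_infty); cbn; try easy.
intros y Hy _; apply: RInt_correct; apply: ex_RInt_continuous; intros z Hz.
apply continuous_gamma_integrand; unfold Rmin in Hz; destruct (Rle_dec 1 y); lra.
Qed.

(** Mean value theorem for [G - F]. Most later inequalities between functions are reduced to their
    derivatives this way. *)
Lemma increment_le (F G f g : R -> R) (a b : R) :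
  a <= b -> (forall x, a <= x <= b -> is_derive F x (f x)) ->
  (forall x, a <= x <= b -> is_derive G x (g x)) ->
  (forall x, a <= x <= b -> f x <= g x) -> F b - F a <= G b - G a.
Proof.
intros Hab HF HG Hle.
destruct (MVT_gen (fun x => G x - F x) a b (fun x => g x - f x)) as (c & Hc & He);
  rewrite ?Rmin_left, ?Rmax_right in * by lra.
- intros x Hx; apply: is_derive_minus; [apply HG | apply HF]; lra.
- intros x Hx; apply continuity_pt_filterlim; apply (ex_derive_continuous (V:=R_NormedModule) (fun x => G x - F x)); eexists.
  apply: is_derive_minus; [apply HG | apply HF]; lra.
- assert (0 <= (g c - f c) * (b - a)); [|lra].
  apply Rmult_le_pos; [specialize (Hle c Hc)|]; lra.
Qed.

(** The primitive based at 1 is increasing. To the right of 1 the integrand is at most [exp (- s)],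
    because [x - 1 <= 0]; to the left it is at most [s^(x-1)], whose integral over (0,1) is
    [1/x]. *)
Lemma gamma_primitive_limits (x : R) : 0 < x <= 1 ->
  exists la lb, la < lb /\
    filterlim (RInt (gamma_integrand x) 1) (at_right 0) (locally la) /\
    filterlim (RInt (gamma_integrand x) 1) (Rbar_locally p_infty) (locally lb).
Proof.
intros Hx; pose (F := RInt (gamma_integrand x) 1).
assert (F1 : F 1 = 0) by exact (RInt_point 1 _).
assert (HF : forall t, 0 < t -> is_derive F t (gamma_integrand x t)) by apply is_derive_gamma_primitive.
assert (Hpos : forall t, 0 < gamma_integrand x t).
{ intros t; apply Rmult_lt_0_compat; apply exp_pos. }
assert (Hmono : forall s t, 0 < s <= t -> F s <= F t).
{ intros s t Hst.
  assert (H := increment_le (fun _ => 0) F (fun _ => 0) (gamma_integrand x) s t).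
  assert (0 - 0 <= F t - F s); [|lra].
  apply H; [lra | intros; apply: is_derive_const | intros; apply HF; lra | intros; left; apply Hpos]. }
assert (Hup : forall t, 1 <= t -> F t <= 1).
{ intros t Ht.
  assert (H := increment_le F (fun s => - exp (- s)) (gamma_integrand x) (fun s => exp (- s)) 1 t Ht).
  assert (F t - F 1 <= - exp (- t) - - exp (- 1)).
  { apply H.
    - intros; apply HF; lra.
    - intros; auto_derive; [exact I | ring].
    - intros s Hs; unfold gamma_integrand.
      rewrite <- (Rmult_1_l (exp (- s))) at 2; apply Rmult_le_compat_r; [left; apply exp_pos|].
      apply Rle_trans with (Rpower s 0); [apply Rle_Rpower; lra | rewrite Rpower_O; lra]. }
  assert (exp (- 1) <= 1) by (rewrite <- exp_0; left; apply exp_increasing; lra).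
  assert (Hp := exp_pos (- t)); lra. }
assert (Hlow : forall t, 0 < t <= 1 -> - / x <= F t).
{ intros t Ht.
  assert (H := increment_le F (fun s => / x * Rpower s x) (gamma_integrand x) (fun s => Rpower s (x - 1)) t 1).
  assert (F 1 - F t <= / x * Rpower 1 x - / x * Rpower t x).
  { apply H; [lra | intros; apply HF; lra | |].
    - intros s Hs.
      replace (Rpower s (x - 1)) with (/ x * (x * Rpower s (x - 1))) by (field; lra).
      apply: is_derive_scal; apply is_derive_Rpower; lra.
    - intros s Hs; unfold gamma_integrand.
      rewrite <- (Rmult_1_r (Rpower s (x - 1))) at 2; apply Rmult_le_compat_l; [left; apply exp_pos|].
      rewrite <- exp_0; destruct (Req_dec s 0); [subst; lra | left; apply exp_increasing; lra]. }
  assert (0 < / x) by (apply Rinv_0_lt_compat; lra).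
  assert (Rpower 1 x = 1) by (unfold Rpower; rewrite ln_1, Rmult_0_r; apply exp_0).
  assert (0 < / x * Rpower t x) by (apply Rmult_lt_0_compat; [lra | apply Rpower_pos]).
  nra. }
assert (0 < / x) by (apply Rinv_0_lt_compat; lra).
destruct (monotone_bounded_limits F (- / x) 1 Hmono) as (la & lb & Hla & Hlb & Hb).
{ intros t Ht; destruct (Rle_dec t 1) as [h|h].
  - split; [apply Hlow; lra | apply Rle_trans with (F 1); [apply Hmono | apply Hup]; lra].
  - split; [apply Rle_trans with (F 1); [lra | apply Hmono; lra] | apply Hup; lra]. }
exists la, lb; repeat split; [|exact Hla|exact Hlb].
(* The limits are strictly ordered because [F 1 < F 2] separates them. *)
apply Rle_lt_trans with (F 1); [apply Hb; lra|].
apply Rlt_le_trans with (F 2); [|apply Hb; lra].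
rewrite F1; apply RInt_gt_0; [lra | intros; apply Hpos | intros; apply continuous_gamma_integrand; lra].
Qed.

Lemma Gamma_primitive (F : R -> R) (x la lb : R) :
  (forall t, 0 < t -> is_derive F t (gamma_integrand x t)) ->
  filterlim F (at_right 0) (locally la) ->
  filterlim F (Rbar_locally p_infty) (locally lb) -> Gamma x = lb - la.
Proof.
intros Hd Ha Hb; apply is_RInt_gen_unique.
apply (is_RInt_gen_primitive F _ (at_right 0) (Rbar_locally p_infty)); [|exact Ha|exact Hb].
exists (fun x => 0 < x < 1) (fun x => 1 < x);
  [exact (at_right_gt _ _ Rlt_0_1) | exists 1; auto |].
cbn; intros y z Hy Hz t Ht.
assert (0 < t) by (unfold Rmin in Ht; destruct (Rle_dec y z); lra).
split; [apply Hd | apply continuous_gamma_integrand]; assumption.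
Qed.

Lemma Gamma_pos (x : R) : 0 < x <= 1 -> 0 < Gamma x.
Proof.
intros Hx; destruct (gamma_primitive_limits x Hx) as (la & lb & Hlt & Ha & Hb).
rewrite (Gamma_primitive _ x la lb (is_derive_gamma_primitive x) Ha Hb); lra.
Qed.

(* [t^x exp(-t) <= t exp(-t) <= 4 / t], since [exp t = exp(t/2)^2 >= t^2/4]. *)
Lemma filterlim_Rpower_exp (x : R) : 0 < x <= 1 ->
  filterlim (fun t => Rpower t x * exp (- t)) (Rbar_locally p_infty) (locally 0).
Proof.
intros Hx; apply filterlim_eps; [typeclasses eauto|]; intros e He.
exists (Rmax 1 (4 / e)); intros t Ht.
assert (Ht1 : 1 < t) by (apply Rle_lt_trans with (2 := Ht); apply Rmax_l).
assert (Hte : 4 / e < t) by (apply Rle_lt_trans with (2 := Ht); apply Rmax_r).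
rewrite Rminus_0_r, Rabs_pos_eq
  by (left; apply Rmult_lt_0_compat; [apply Rpower_pos | apply exp_pos]).
assert (Hp : Rpower t x <= t).
{ rewrite <- (Rpower_1 t) at 2 by lra; apply Rle_Rpower; lra. }
assert (Hexp : t * t / 4 <= exp t).
{ replace t with (t / 2 + t / 2) at 3 by field; rewrite exp_plus.
  assert (h := exp_ineq1_le (t / 2)); nra. }
assert (Hm : exp (- t) * exp t = 1) by (rewrite <- exp_plus, Rplus_opp_l; apply exp_0).
assert (Hep := exp_pos (- t)).
assert (4 < t * e) by (apply (Rmult_lt_compat_r e) in Hte; [unfold Rdiv in Hte; rewrite Rmult_assoc, Rinv_l in Hte; lra | lra]).
apply Rle_lt_trans with (t * exp (- t)); [apply Rmult_le_compat_r; lra|].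
assert (exp (- t) * (t * t / 4) <= 1) by (rewrite <- Hm; apply Rmult_le_compat_l; lra).
assert (t * exp (- t) * (t / 4) <= 1) by lra.
assert (1 < e * (t / 4)) by lra.
apply Rnot_le_lt; intros Hn.
assert (e * (t / 4) <= t * exp (- t) * (t / 4)) by (apply Rmult_le_compat_r; lra).
lra.
Qed.

(** Integration by parts at the level of primitives: if [F] is a primitive for [x], then
    [x F - t^x exp(-t)] is one for [x + 1], and the boundary term vanishes at both ends. *)
Lemma Gamma_succ (x : R) : 0 < x <= 1 -> Gamma (x + 1) = x * Gamma x.
Proof.
intros Hx; destruct (gamma_primitive_limits x Hx) as (la & lb & Hlt & Ha & Hb).
rewrite (Gamma_primitive _ x la lb (is_derive_gamma_primitive x) Ha Hb).
rewrite (Gamma_primitive (fun t => x * RInt (gamma_integrand x) 1 t - Rpower t x * exp (- t))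
           (x + 1) (x * la - 0) (x * lb - 0)); [ring | | |].
- intros t Ht.
  replace (gamma_integrand (x + 1) t)
    with (x * gamma_integrand x t
          - (x * Rpower t (x - 1) * exp (- t) + Rpower t x * (- exp (- t)))).
  + apply: is_derive_minus; [apply: is_derive_scal; apply is_derive_gamma_primitive; exact Ht|].
    apply: is_derive_mult; [apply is_derive_Rpower; exact Ht | | intros; apply Rmult_comm].
    auto_derive; [exact I | ring].
  + unfold gamma_integrand; replace (x + 1 - 1) with x by ring; ring.
- apply filterlim_Rminus; [typeclasses eauto | exact (filterlim_comp _ _ _ _ _ _ _ _ Ha (filterlim_scal_r x la)) |].
  apply filterlim_eps; [typeclasses eauto|]; intros e He.
  generalize (proj1 (filterlim_locally _ _) (filterlim_Rpower_0 x (proj1 Hx)) (mkposreal e He)).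
  intros H; generalize (filter_and _ _ H (at_right_gt 0 1 Rlt_0_1)); apply filter_imp; intros t [H1 Ht].
  change (Rabs (Rpower t x - 0) < e) in H1.
  rewrite Rminus_0_r in *; rewrite Rabs_mult, (Rabs_pos_eq (exp _)) by (left; apply exp_pos).
  assert (exp (- t) <= 1) by (rewrite <- exp_0; left; apply exp_increasing; lra).
  assert (Hp := exp_pos (- t)); assert (Hq := Rabs_pos (Rpower t x)); nra.
- apply filterlim_Rminus; [typeclasses eauto | exact (filterlim_comp _ _ _ _ _ _ _ _ Hb (filterlim_scal_r x lb)) |].
  apply filterlim_Rpower_exp; exact Hx.
Qed.

(** * Integrals over one cell *)

(** Comparison with an integrand whose primitive is explicit. It reduces the cell estimates below to
    a pointwise inequality and an algebraic identity. *)
Lemma RInt_le_primitive (f G g : R -> R) (a b : R) :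
  a <= b -> (forall x, a <= x <= b -> continuous f x) ->
  (forall x, is_derive G x (g x)) -> (forall x, continuous g x) ->
  (forall x, a < x < b -> f x <= g x) -> RInt f a b <= G b - G a.
Proof.
intros Hab Hf HG Hg Hle.
assert (HI : is_RInt g a b (G b - G a)) by (apply: is_RInt_derive; intros; auto).
rewrite <- (is_RInt_unique _ _ _ _ HI); apply RInt_le; auto.
- apply: ex_RInt_continuous; rewrite Rmin_left, Rmax_right by lra; exact Hf.
- eexists; exact HI.
Qed.

Lemma RInt_ge_primitive (f G g : R -> R) (a b : R) :
  a <= b -> (forall x, a <= x <= b -> continuous f x) ->
  (forall x, is_derive G x (g x)) -> (forall x, continuous g x) ->
  (forall x, a < x < b -> g x <= f x) -> G b - G a <= RInt f a b.
Proof.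
intros Hab Hf HG Hg Hle.
assert (HI : is_RInt g a b (G b - G a)) by (apply: is_RInt_derive; intros; auto).
rewrite <- (is_RInt_unique _ _ _ _ HI); apply RInt_le; auto.
- eexists; exact HI.
- apply: ex_RInt_continuous; rewrite Rmin_left, Rmax_right by lra; exact Hf.
Qed.

Lemma continuous_poly1 (p q x : R) : continuous (fun s => p + q * s) x.
Proof. apply: ex_derive_continuous; auto_derive; exact I. Qed.

Lemma continuous_affine_mult (f : R -> R) (c x : R) :
  continuous f x -> continuous (fun s => (s - c) * f s) x.
Proof.
intros Hf; apply: continuous_mult; [|exact Hf].
apply: ex_derive_continuous; auto_derive; exact I.
Qed.

Section CellIntegrals.
Variables (f : R -> R) (a b : R).
Hypotheses (Hab : a < b) (Hc : forall x, a <= x <= b -> continuous f x).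

(** First moment of [f] about the midpoint of the cell, the integral that occurs in [bcoef]. *)
Definition moment : R := RInt (fun s => (s - (b + a) / 2) * f s) a b.

(** Replacing [f] by its midpoint value lowers the integrand on both halves of the cell, and the
    moment of a constant vanishes by symmetry. *)
Lemma moment_ge0 : (forall x y, a <= x -> x <= y -> y <= b -> f x <= f y) -> 0 <= moment.
Proof.
intros Hm; pose (mid := (b + a) / 2).
assert (H := RInt_ge_primitive (fun s => (s - (b + a) / 2) * f s)
  (fun s => f mid * ((s - mid) ^ 2 / 2)) (fun s => (- f mid * mid) + f mid * s) a b).
assert (f mid * ((b - mid) ^ 2 / 2) - f mid * ((a - mid) ^ 2 / 2) <= moment).
{ apply H.
  - lra.
  - intros; apply continuous_affine_mult; auto.
  - intros; auto_derive; [exact I | field].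
  - intros; apply continuous_poly1.
  - intros x Hx; change ((b + a) / 2) with mid.
    assert (Hmid : a < mid < b) by (unfold mid; lra).
    destruct (Rle_dec x mid).
    + assert (f x <= f mid) by (apply Hm; lra); nra.
    + assert (f mid <= f x) by (apply Hm; lra); nra. }
replace ((a - mid) ^ 2) with ((b - mid) ^ 2) in H0 by (unfold mid; field); lra.
Qed.

(** Subtracting the midpoint value leaves an integrand of at most [D (s - mid)^2], whose integral is
    [D (b - a)^3 / 12]. *)
Lemma moment_le (D : R) :
  (forall x y, a <= x -> x <= y -> y <= b -> f y - f x <= D * (y - x)) ->
  moment <= D * (b - a) ^ 3 / 12.
Proof.
intros Hm; pose (mid := (b + a) / 2).
assert (H := RInt_le_primitive (fun s => (s - (b + a) / 2) * f s)
  (fun s => f mid * ((s - mid) ^ 2 / 2) + D * ((s - mid) ^ 3 / 3))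
  (fun s => f mid * (s - mid) + D * (s - mid) ^ 2) a b).
assert (moment <= (f mid * ((b - mid) ^ 2 / 2) + D * ((b - mid) ^ 3 / 3))
                  - (f mid * ((a - mid) ^ 2 / 2) + D * ((a - mid) ^ 3 / 3))).
{ apply H.
  - lra.
  - intros; apply continuous_affine_mult; auto.
  - intros; auto_derive; [exact I | field].
  - intros; apply: ex_derive_continuous; auto_derive; exact I.
  - intros x Hx; change ((b + a) / 2) with mid.
    assert (Hmid : a < mid < b) by (unfold mid; lra).
    destruct (Rle_dec x mid).
    + assert (f mid - f x <= D * (mid - x)) by (apply Hm; lra); nra.
    + assert (f x - f mid <= D * (x - mid)) by (apply Hm; lra); nra. }
apply Rle_trans with (1 := H0); right; unfold mid; field.
Qed.

(** On the cell, [f] lies below the line of slope [D] through its right end value. *)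
Lemma RInt_le_slope (D : R) :
  (forall x, a <= x <= b -> D * (b - x) <= f b - f x) ->
  RInt f a b <= (b - a) * f b - D * (b - a) ^ 2 / 2.
Proof.
intros Hm.
assert (H := RInt_le_primitive f
  (fun s => f b * s + D * ((b - s) ^ 2 / 2)) (fun s => f b - D * b + D * s) a b).
apply Rle_trans with ((f b * b + D * ((b - b) ^ 2 / 2)) - (f b * a + D * ((b - a) ^ 2 / 2))).
- apply H.
  + lra.
  + exact Hc.
  + intros; auto_derive; [exact I | field].
  + intros; apply continuous_poly1.
  + intros x Hx; specialize (Hm x); lra.
- right; field.
Qed.

(* The weight [1/(b-a) - 2/((b-a)(b-a+c)) (s - mid)] is nonnegative with integral 1. *)
Lemma mean_sub_moment_ge (c : R) : 0 <= c ->
  (forall x, a <= x <= b -> f a <= f x) ->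
  f a <= / (b - a) * RInt f a b - 2 / ((b - a) * (b - a + c)) * moment.
Proof.
intros Hc0 Hm.
pose (q := 2 / ((b - a) * (b - a + c))); pose (mid := (b + a) / 2).
assert (Hq : q * ((b - a) / 2) <= / (b - a)).
{ unfold q; replace (2 / ((b - a) * (b - a + c)) * ((b - a) / 2)) with (/ (b - a + c)) by (field; lra).
  apply Rinv_le_contravar; lra. }
assert (Hq0 : 0 < q) by (apply Rdiv_lt_0_compat; [lra | apply Rmult_lt_0_compat; lra]).
assert (HI : is_RInt (fun s => / (b - a) * f s - q * ((s - mid) * f s)) a b
               (/ (b - a) * RInt f a b - q * moment)).
{ apply: is_RInt_minus; apply: is_RInt_scal; apply: RInt_correct; apply: ex_RInt_continuous;
    rewrite Rmin_left, Rmax_right by lra; [exact Hc | intros; apply continuous_affine_mult; auto]. }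
change (f a <= / (b - a) * RInt f a b - q * moment).
rewrite <- (is_RInt_unique _ _ _ _ HI).
assert (H := RInt_ge_primitive (fun s => / (b - a) * f s - q * ((s - mid) * f s))
  (fun s => f a * (/ (b - a) * s - q * ((s - mid) ^ 2 / 2)))
  (fun s => f a * (/ (b - a) - q * (s - mid))) a b).
apply Rle_trans with (f a * (/ (b - a) * b - q * ((b - mid) ^ 2 / 2))
                      - f a * (/ (b - a) * a - q * ((a - mid) ^ 2 / 2))).
- right; unfold mid; field; lra.
- apply H.
  + lra.
  + intros x Hx; apply: continuous_minus; apply: continuous_mult;
      try apply continuous_const; [apply Hc; exact Hx | apply continuous_affine_mult; apply Hc; exact Hx].
  + intros; auto_derive; [exact I | field; lra].
  + intros; apply: ex_derive_continuous; auto_derive; exact I.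
  + intros x Hx.
    replace (/ (b - a) * f x - q * ((x - mid) * f x)) with (f x * (/ (b - a) - q * (x - mid))) by ring.
    apply Rmult_le_compat_r; [|apply Hm; lra].
    assert (q * (x - mid) <= q * ((b - a) / 2)) by (apply Rmult_le_compat_l; unfold mid; lra).
    lra.
Qed.
End CellIntegrals.

(** * The convolution coefficients *)

Lemma is_derive_Rpower_sub (T y s : R) : s < T ->
  is_derive (fun s => Rpower (T - s) y) s (- (y * Rpower (T - s) (y - 1))).
Proof.
intros Hs.
replace (- (y * Rpower (T - s) (y - 1))) with (scal (-1) (y * Rpower (T - s) (y - 1)))
  by (unfold scal; cbn; unfold mult; cbn; ring).
apply: (is_derive_comp (fun z => Rpower z y) (fun s => T - s)).
- apply is_derive_Rpower; lra.
- auto_derive; [exact I | ring].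
Qed.

(** * The kernel and its convexity *)

Definition kern (alpha T s : R) : R := omega (1 - alpha) (T - s).
Definition dkern (alpha T s : R) : R := alpha * Rpower (T - s) (- alpha - 1) / Gamma (1 - alpha).

Section Kernel.
Variables (alpha T : R).
Hypothesis (Halpha : 0 < alpha < 1).

Lemma Gamma_one_sub_pos : 0 < Gamma (1 - alpha).
Proof. apply Gamma_pos; lra. Qed.

Lemma is_derive_kern (s : R) : s < T -> is_derive (kern alpha T) s (dkern alpha T s).
Proof.
intros Hs; assert (Hg := Gamma_one_sub_pos).
replace (dkern alpha T s)
  with (/ Gamma (1 - alpha) * - ((1 - alpha - 1) * Rpower (T - s) (1 - alpha - 1 - 1))).
- apply (is_derive_ext (fun s => / Gamma (1 - alpha) * Rpower (T - s) (1 - alpha - 1))).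
  + intros; apply Rmult_comm.
  + apply is_derive_scal; apply is_derive_Rpower_sub; exact Hs.
- unfold dkern; replace (1 - alpha - 1 - 1) with (- alpha - 1) by ring; field; lra.
Qed.

Lemma continuous_kern (s : R) : s < T -> continuous (kern alpha T) s.
Proof. intros Hs; apply: ex_derive_continuous; eexists; apply is_derive_kern; exact Hs. Qed.

Lemma kern_pos (s : R) : 0 < kern alpha T s.
Proof. apply Rdiv_lt_0_compat; [apply Rpower_pos | apply Gamma_one_sub_pos]. Qed.

Lemma dkern_pos (s : R) : 0 < dkern alpha T s.
Proof.
apply Rdiv_lt_0_compat; [|apply Gamma_one_sub_pos].
apply Rmult_lt_0_compat; [lra | apply Rpower_pos].
Qed.

(** This is the convexity of the kernel. The two increment bounds that follow compare a secant slope
    with the derivative to its right and to its left. *)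
Lemma dkern_mono (s u : R) : s <= u -> u < T -> dkern alpha T s <= dkern alpha T u.
Proof.
intros Hsu Hu; apply Rmult_le_compat_r; [left; apply Rinv_0_lt_compat; apply Gamma_one_sub_pos|].
apply Rmult_le_compat_l; [lra|].
replace (- alpha - 1) with (- (alpha + 1)) by ring; rewrite !Rpower_Ropp.
apply Rinv_le_contravar; [apply Rpower_pos | apply Rle_Rpower_l; lra].
Qed.

Lemma kern_increment_le (x y u : R) : x <= y -> y <= u -> u < T ->
  kern alpha T y - kern alpha T x <= dkern alpha T u * (y - x).
Proof.
intros Hxy Hyu Hu; rewrite Rmult_minus_distr_l.
apply (increment_le (kern alpha T) (fun s => dkern alpha T u * s) (dkern alpha T) (fun _ => dkern alpha T u) x y).
- exact Hxy.
- intros; apply is_derive_kern; lra.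
- intros; auto_derive; [exact I | ring].
- intros; apply dkern_mono; lra.
Qed.

Lemma kern_increment_ge (x y u : R) : u <= x -> x <= y -> y < T ->
  dkern alpha T u * (y - x) <= kern alpha T y - kern alpha T x.
Proof.
intros Hux Hxy Hy; rewrite Rmult_minus_distr_l.
apply (increment_le (fun s => dkern alpha T u * s) (kern alpha T) (fun _ => dkern alpha T u) (dkern alpha T) x y).
- exact Hxy.
- intros; auto_derive; [exact I | ring].
- intros; apply is_derive_kern; lra.
- intros; apply dkern_mono; lra.
Qed.

Lemma kern_mono (x y : R) : x <= y -> y < T -> kern alpha T x <= kern alpha T y.
Proof.
intros Hxy Hy; assert (H := kern_increment_ge x y x (Rle_refl _) Hxy Hy).
assert (Hp := dkern_pos x); nra.
Qed.

(** The integral runs up to the singularity, where the primitive [- (T - s)^(1-alpha) / ((1-alpha)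
    Gamma(1-alpha))] still tends to 0. *)
Lemma integ_kern_end (a : R) : a < T ->
  integ (kern alpha T) a T = (T - a) / (1 - alpha) * kern alpha T a.
Proof.
intros Ha; assert (Hg := Gamma_one_sub_pos).
pose (k := / ((1 - alpha) * Gamma (1 - alpha))).
assert (Hk : 0 < k) by (apply Rinv_0_lt_compat; apply Rmult_lt_0_compat; lra).
assert (HF : forall x, x < T -> is_derive (fun s => - k * Rpower (T - s) (1 - alpha)) x (kern alpha T x)).
{ intros x Hx; replace (kern alpha T x)
    with (- k * - ((1 - alpha) * Rpower (T - x) (1 - alpha - 1))) by (unfold kern, omega, k; field; lra).
  apply is_derive_scal; apply is_derive_Rpower_sub; exact Hx. }
rewrite (integ_primitive (fun s => - k * Rpower (T - s) (1 - alpha)) _ a T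
           (- k * Rpower (T - a) (1 - alpha)) (- k * 0)).
- rewrite (Rpower_pred (T - a)) by lra; unfold kern, omega, k; field; lra.
- exact Ha.
- intros x Hx; split; [apply HF | apply continuous_kern]; lra.
- eapply filterlim_filter_le_1; [apply filter_le_within|].
  apply: (ex_derive_continuous (fun s => - k * Rpower (T - s) (1 - alpha))).
  eexists; apply HF; exact Ha.
- apply (filterlim_comp _ _ _ (fun s => Rpower (T - s) (1 - alpha)) (Rmult (- k)) _ (locally 0)).
  (* The substitution [z = T - s] carries the left limit at [T] to the right limit at 0. *)
  + apply (filterlim_comp _ _ _ (fun s => T - s) (fun z => Rpower z (1 - alpha)) _ (at_right 0));
      [|apply filterlim_Rpower_0; lra].
    intros P [e He]; exists e; intros y Hy HyT; apply He; [|lra].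
    change (Rabs (y - T) < e) in Hy; change (Rabs (T - y - 0) < e).
    rewrite Rminus_0_r, Rabs_minus_sym; exact Hy.
  + apply (filterlim_scal_r (- k) 0).
Qed.
End Kernel.

(** * Bounds on the coefficients of the discrete derivative *)

Section Coefficients.
Variables (alpha : R) (t : nat -> R) (n : nat).
Hypotheses (Halpha : 0 < alpha < 1)
  (Ht : forall k, (k < n)%nat -> t k < t (S k))
  (Hratio : forall k, (2 <= k <= n)%nat -> ratio t k >= 4 / 7).
Let g := kern alpha (tsig alpha t n).
Let dg := dkern alpha (tsig alpha t n).

Lemma tau_S (k : nat) : tau t (S k) = t (S k) - t k.
Proof. unfold tau; rewrite Nat.sub_succ, Nat.sub_0_r; reflexivity. Qed.

Lemma tau_S_pos (k : nat) : (k < n)%nat -> 0 < tau t (S k).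
Proof. intros Hk; rewrite tau_S; specialize (Ht k Hk); lra. Qed.

(** Holds since [t k <= t (n-1)] and [alpha / 2 < 1]. Hence all cells but the last stay away from
    the singularity of the kernel. *)
Lemma grid_lt_tsig (k : nat) : (k < n)%nat -> t k < tsig alpha t n.
Proof.
intros Hk; assert (Hm : forall p, (k + p < n)%nat -> t k <= t (k + p)%nat).
{ induction p as [|p IH]; intros Hp; [rewrite Nat.add_0_r; lra|].
  rewrite Nat.add_succ_r; specialize (Ht (k + p)%nat ltac:(lia)); specialize (IH ltac:(lia)); lra. }
destruct n as [|n']; [lia|].
specialize (Hm (n' - k)%nat ltac:(lia)); replace (k + (n' - k))%nat with n' in Hm by lia.
specialize (Ht n' ltac:(lia)); unfold tsig; rewrite Nat.sub_succ, Nat.sub_0_r; nra.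
Qed.

Lemma continuous_kern_tsig (x : R) : x < tsig alpha t n -> continuous g x.
Proof. apply continuous_kern; exact Halpha. Qed.

Lemma acoef_cell (k : nat) : (S k < n)%nat ->
  acoef alpha t n (S k) = / tau t (S k) * RInt g (t k) (t (S k)).
Proof.
intros Hk; unfold acoef; rewrite Nat.sub_succ, Nat.sub_0_r.
assert (H := grid_lt_tsig (S k) Hk); rewrite Rmin_left by lra; f_equal.
apply (integ_RInt _ _ _ (tsig alpha t n)); [|exact continuous_kern_tsig].
split; [apply Ht; lia | exact H].
Qed.

Lemma bcoef_cell (k : nat) : (S k < n)%nat ->
  bcoef alpha t n (S k) = 2 / (tau t (S k) * (tau t (S k) + tau t (S (S k)))) * moment g (t k) (t (S k)).
Proof.
intros Hk; unfold bcoef; rewrite Nat.sub_succ, Nat.sub_0_r, Nat.add_1_r; f_equal.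
apply (integ_RInt (fun s => (s - (t (S k) + t k) / 2) * g s) _ _ (tsig alpha t n)).
- split; [apply Ht; lia | apply grid_lt_tsig; exact Hk].
- intros x Hx; apply continuous_affine_mult; apply continuous_kern_tsig; exact Hx.
Qed.

(** The last cell is cut off at the singularity. The remaining length is [1 - alpha/2] times the
    step, and the step cancels against the prefactor. *)
Lemma acoef_last (k : nat) : n = S k ->
  acoef alpha t n n = (1 - alpha / 2) / (1 - alpha) * g (t k).
Proof.
intros Hn; assert (Hk : (k < n)%nat) by lia.
assert (Hp := tau_S_pos k Hk); rewrite tau_S in Hp.
assert (Hlt := grid_lt_tsig k Hk).
assert (HT : tsig alpha t n = t (S k) - alpha / 2 * (t (S k) - t k)).
{ unfold tsig; rewrite Hn, Nat.sub_succ, Nat.sub_0_r; ring. }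
unfold acoef, tau; replace (n - 1)%nat with k by lia.
replace (t n) with (t (S k)) by (rewrite Hn; reflexivity).
assert (Hap : 0 < alpha * (t (S k) - t k)) by (apply Rmult_lt_0_compat; lra).
rewrite Rmin_right by (rewrite HT; lra).
transitivity (/ (t (S k) - t k) * integ g (t k) (tsig alpha t n)); [reflexivity|].
unfold g; rewrite (integ_kern_end alpha (tsig alpha t n) Halpha (t k) Hlt).
rewrite HT at 1; field; lra.
Qed.

Lemma cell_continuous (k : nat) : (S k < n)%nat -> forall x, t k <= x <= t (S k) -> continuous g x.
Proof. intros Hk x Hx; apply continuous_kern_tsig; assert (H := grid_lt_tsig (S k) Hk); lra. Qed.

Lemma bcoef_ge0 (k : nat) : (S k < n)%nat -> 0 <= bcoef alpha t n (S k).
Proof.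
intros Hk; rewrite bcoef_cell by exact Hk.
assert (H1 := tau_S_pos k ltac:(lia)); assert (H2 := tau_S_pos (S k) Hk).
apply Rmult_le_pos.
- left; apply Rdiv_lt_0_compat; [lra | apply Rmult_lt_0_compat; lra].
- apply moment_ge0; [apply Ht; lia | apply cell_continuous; exact Hk |].
  intros x y Hx Hxy Hy; apply kern_mono; [exact Halpha | exact Hxy |].
  assert (H := grid_lt_tsig (S k) Hk); lra.
Qed.

(** With [c] equal to the next step, the weight in [mean_sub_moment_ge] has exactly the prefactor of
    [bcoef]. *)
Lemma acoef_sub_bcoef_ge (k : nat) : (S k < n)%nat ->
  g (t k) <= acoef alpha t n (S k) - bcoef alpha t n (S k).
Proof.
intros Hk; rewrite acoef_cell, bcoef_cell by exact Hk.
assert (H2 := tau_S_pos (S k) Hk); rewrite (tau_S k).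
apply mean_sub_moment_ge; [apply Ht; lia | apply cell_continuous; exact Hk | lra |].
intros x Hx; apply kern_mono; [exact Halpha | lra |].
assert (H := grid_lt_tsig (S k) Hk); lra.
Qed.

(** The convexity deficit [dg (t k) * tau t (S k) / 2] is kept because it is what absorbs the
    contribution of the preceding cell, bounded in [bcoef_div_ratio_le]. *)
Lemma acoef_le (k : nat) : (S k < n)%nat ->
  acoef alpha t n (S k) <= g (t (S k)) - dg (t k) * tau t (S k) / 2.
Proof.
intros Hk; rewrite acoef_cell by exact Hk.
assert (H1 := tau_S_pos k ltac:(lia)); assert (H := grid_lt_tsig (S k) Hk).
assert (HI : RInt g (t k) (t (S k)) <=
  (t (S k) - t k) * g (t (S k)) - dg (t k) * (t (S k) - t k) ^ 2 / 2).
{ apply RInt_le_slope; [apply Ht; lia | apply cell_continuous; exact Hk |].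
  intros x Hx; apply kern_increment_ge; lra. }
rewrite <- tau_S in HI.
apply (Rmult_le_compat_l (/ tau t (S k))) in HI; [|left; apply Rinv_0_lt_compat; exact H1].
apply Rle_trans with (1 := HI); right; field; lra.
Qed.

(* Only here does the mesh restriction enter: it gives [p^3 <= 3 q^2 (p + q)] for consecutive steps [p], [q]. *)
Lemma bcoef_div_ratio_le (k : nat) : (S (S k) < n)%nat ->
  bcoef alpha t n (S k) / ratio t (S (S k)) <= dg (t (S k)) * tau t (S (S k)) / 2.
Proof.
intros Hk; rewrite bcoef_cell by lia.
assert (Hr := Hratio (S (S k)) ltac:(lia)).
assert (H := grid_lt_tsig (S k) ltac:(lia)).
assert (HD : 0 < dg (t (S k))) by (apply dkern_pos; exact Halpha).
assert (Hm : moment g (t k) (t (S k)) <= dg (t (S k)) * (t (S k) - t k) ^ 3 / 12).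
{ apply moment_le; [apply Ht; lia | apply cell_continuous; lia |].
  intros x y Hx Hxy Hy; apply kern_increment_le; lra. }
rewrite <- tau_S in Hm.
unfold ratio in *; rewrite Nat.sub_succ, Nat.sub_0_r in *.
assert (Hp := tau_S_pos k ltac:(lia)); assert (Hq := tau_S_pos (S k) ltac:(lia)).
set (p := tau t (S k)) in *; set (q := tau t (S (S k))) in *; set (D := dg (t (S k))) in *.
assert (Hpq : p <= 7 / 4 * q).
{ apply Rge_le in Hr; apply (Rmult_le_compat_r p) in Hr; [|lra].
  unfold Rdiv in Hr at 2; rewrite Rmult_assoc, Rinv_l in Hr; lra. }
apply Rle_trans with (2 / (p * (p + q)) * (D * p ^ 3 / 12) / (q / p)).
- apply Rmult_le_compat_r; [left; apply Rinv_0_lt_compat; apply Rdiv_lt_0_compat; lra|].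
  apply Rmult_le_compat_l; [|exact Hm].
  left; apply Rdiv_lt_0_compat; [lra | apply Rmult_lt_0_compat; lra].
- replace (2 / (p * (p + q)) * (D * p ^ 3 / 12) / (q / p)) with (D / (6 * q * (p + q)) * p ^ 3) by (field; lra).
  replace (D * q / 2) with (D / (6 * q * (p + q)) * (3 * q ^ 2 * (p + q))) by (field; lra).
  apply Rmult_le_compat_l.
  + left; apply Rdiv_lt_0_compat; [lra | apply Rmult_lt_0_compat; lra].
  (* From [p <= 7/4 q], [p^3 <= 49/16 p q^2]. The excess over [3 p q^2] is [p q^2 / 16 <= 7/64 q^3],
     well below [3 q^3]. *)
  + assert (p * p <= 7 / 4 * q * (7 / 4 * q)) by (apply Rmult_le_compat; lra).
    assert (p * (p * p) <= p * (7 / 4 * q * (7 / 4 * q))) by (apply Rmult_le_compat_l; lra).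
    assert (p * (q * q) <= 7 / 4 * q * (q * q)) by (apply Rmult_le_compat_r; nra).
    assert (0 < q * (q * q)) by (apply Rmult_lt_0_compat; nra).
    lra.
Qed.

(** Consecutive intervals share an endpoint, so the coefficients before the last are positive and
    nondecreasing in [k] without comparing integrals over different cells. *)
Lemma Bcoef_bounds (k : nat) : (S k < n)%nat ->
  g (t k) <= Bcoef alpha t n (S k) <= g (t (S k)).
Proof.
intros Hk; unfold Bcoef.
replace (n =? 1)%nat with false by (symmetry; apply Nat.eqb_neq; lia).
replace (S k =? n)%nat with false by (symmetry; apply Nat.eqb_neq; lia).
assert (Hab := acoef_sub_bcoef_ge k Hk); assert (Ha := acoef_le k Hk); assert (Hb := bcoef_ge0 k Hk).
assert (HD : 0 < dg (t k)) by (apply dkern_pos; exact Halpha).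
assert (Hp := tau_S_pos k ltac:(lia)).
assert (0 < dg (t k) * tau t (S k)) by (apply Rmult_lt_0_compat; assumption).
(* The first coefficient has no preceding cell, so its convexity deficit is simply dropped. *)
destruct k as [|k]; cbn [Nat.eqb].
- split; lra.
- rewrite Nat.sub_succ, Nat.sub_0_r.
  assert (Hr := bcoef_div_ratio_le k Hk).
  assert (Hbr : 0 <= bcoef alpha t n (S k) / ratio t (S (S k))).
  { apply Rmult_le_pos; [apply bcoef_ge0; lia|].
    left; apply Rinv_0_lt_compat; specialize (Hratio (S (S k)) ltac:(lia)); lra. }
  split; lra.
Qed.

Lemma Bcoef_last_ge (k : nat) : n = S k ->
  (1 - alpha / 2) / (1 - alpha) * g (t k) <= Bcoef alpha t n n.
Proof.
intros Hn; rewrite <- (acoef_last k Hn); unfold Bcoef; rewrite Nat.eqb_refl.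
destruct (Nat.eqb_spec n 1) as [->|Hn1]; [lra|].
assert (0 <= bcoef alpha t n (n - 1) / ratio t n); [|lra].
apply Rmult_le_pos.
- replace (n - 1)%nat with (S (n - 2)) by lia; apply bcoef_ge0; lia.
- left; apply Rinv_0_lt_compat; specialize (Hratio n ltac:(lia)); lra.
Qed.

(* Since [alpha = 2 vs], the bound [Bcoef_last_ge] leaves the gap [vs / (1 - alpha) * g (t k)] above [g (t k)]. *)
Lemma Bcoef_last_gap (k : nat) (Q : R) : n = S k -> Q <= g (t k) ->
  alpha / 2 / Gamma (2 - alpha) * Rpower (tau t n) (- alpha) <= Bcoef alpha t n n - Q.
Proof.
intros Hn HQ; assert (HB := Bcoef_last_ge k Hn).
assert (Hg := Gamma_one_sub_pos alpha Halpha).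
assert (Hp := tau_S_pos k ltac:(lia)).
assert (HT : tsig alpha t n - t k = (1 - alpha / 2) * tau t n).
{ unfold tsig; rewrite Hn, tau_S, Nat.sub_succ, Nat.sub_0_r; ring. }
assert (Hk : / Gamma (1 - alpha) * Rpower (tau t n) (- alpha) <= g (t k)).
{ unfold g, kern, omega; rewrite HT; replace (1 - alpha - 1) with (- alpha) by ring.
  unfold Rdiv; rewrite (Rmult_comm (/ _)); apply Rmult_le_compat_r; [left; apply Rinv_0_lt_compat; exact Hg|].
  rewrite !Rpower_Ropp; apply Rinv_le_contravar; [apply Rpower_pos|].
  (* The factor [1 - alpha/2] is at most 1 and the exponent [- alpha] is negative, so dropping the
     factor lowers the power. *)
  rewrite <- Hn in Hp; apply Rle_Rpower_l; [lra | split; nra]. }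
replace (2 - alpha) with (1 - alpha + 1) by ring; rewrite Gamma_succ by lra.
apply Rle_trans with (alpha / 2 / (1 - alpha) * g (t k)).
- apply Rle_trans with (alpha / 2 / (1 - alpha) * (/ Gamma (1 - alpha) * Rpower (tau t n) (- alpha))).
  + right; field; lra.
  + apply Rmult_le_compat_l; [|exact Hk].
    left; apply Rdiv_lt_0_compat; lra.
- apply Rle_trans with ((1 - alpha / 2) / (1 - alpha) * g (t k) - g (t k)); [|lra].
  right; field; lra.
Qed.
End Coefficients.

(** * The discrete maximum principle *)

(** The conjunct [0 <= X] comes from the start value of the fold. *)
Lemma fold_Rmax_le (A : Type) (w : A -> R) (l : list A) (X : R) :
  fold_right Rmax 0 (map w l) <= X <-> 0 <= X /\ forall a, In a l -> w a <= X.
Proof.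
induction l as [|b l IH]; cbn; [intuition easy|].
split.
- intros H; assert (w b <= X) by (apply Rle_trans with (2 := H); apply Rmax_l).
  destruct (proj1 IH) as [HX Hl]; [apply Rle_trans with (2 := H); apply Rmax_r|].
  split; [exact HX|]; intros a [<-|Ha]; auto.
- intros [HX Hl]; apply Rmax_lub; [apply Hl; left; reflexivity|].
  apply IH; split; auto.
Qed.

Lemma norm_inf_le_iff_idx (M : nat) (v : grid) (X : R) : 0 <= X ->
  norm_inf M v <= X <-> forall i j, In i (idx M) -> In j (idx M) -> Rabs (v i j) <= X.
Proof.
intros HX; unfold norm_inf; rewrite fold_Rmax_le; split.
- intros [_ H] i j Hi Hj; specialize (H i Hi); rewrite fold_Rmax_le in H; apply H; exact Hj.
- intros H; split; [exact HX|]; intros i Hi; rewrite fold_Rmax_le; auto.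
Qed.

Lemma norm_inf_ge0 (M : nat) (v : grid) : 0 <= norm_inf M v.
Proof. exact (proj1 (proj1 (fold_Rmax_le _ _ _ _) (Rle_refl (norm_inf M v)))). Qed.

Lemma periodic_idx (M : nat) (w : Z -> R) (i : Z) : (1 <= M)%nat ->
  (forall i, w (i + Z.of_nat M)%Z = w i) -> exists i', In i' (idx M) /\ w i' = w i.
Proof.
intros HM Hw.
assert (Hn : forall (p : nat) i, w (i + Z.of_nat p * Z.of_nat M)%Z = w i).
{ induction p as [|p IH]; intros k; [f_equal; lia|].
  replace (k + Z.of_nat (S p) * Z.of_nat M)%Z with (k + Z.of_nat p * Z.of_nat M + Z.of_nat M)%Z by lia.
  rewrite Hw; apply IH. }
assert (Hz : forall p i, w (i + p * Z.of_nat M)%Z = w i).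
{ intros p k; destruct (Z_le_dec 0 p).
  - rewrite <- (Hn (Z.to_nat p) k); do 2 f_equal; rewrite Z2Nat.id; lia.
  - rewrite <- (Hn (Z.to_nat (- p)) (k + p * Z.of_nat M)%Z); f_equal; rewrite Z2Nat.id; lia. }
(* The shift by one is due to [idx] running from 1 to [M]. *)
exists ((i - 1) mod Z.of_nat M + 1)%Z; split.
- unfold idx; apply in_map_iff.
  assert (Hmod := Z.mod_pos_bound (i - 1) (Z.of_nat M) ltac:(lia)).
  exists (Z.to_nat ((i - 1) mod Z.of_nat M + 1)); split; [lia | apply in_seq; lia].
- rewrite <- (Hz ((i - 1) / Z.of_nat M)%Z); f_equal.
  assert (H := Z.div_mod (i - 1) (Z.of_nat M) ltac:(lia)); lia.
Qed.

(** Periodicity carries the bound from one period to all indices, so neighbours across the boundary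
    are no special case. *)
Lemma norm_inf_le_iff (M : nat) (v : grid) (X : R) : (1 <= M)%nat -> in_Vh M v -> 0 <= X ->
  norm_inf M v <= X <-> forall i j, Rabs (v i j) <= X.
Proof.
intros HM Hv HX; rewrite norm_inf_le_iff_idx by exact HX; split; [|auto].
intros H i j.
destruct (periodic_idx M (fun i => v i j) i HM) as (i' & Hi' & <-); [intros; apply Hv|].
destruct (periodic_idx M (v i') j HM) as (j' & Hj' & <-); [intros; apply Hv|].
auto.
Qed.

Lemma norm_inf_bound (M : nat) (v : grid) (i j : Z) :
  (1 <= M)%nat -> in_Vh M v -> Rabs (v i j) <= norm_inf M v.
Proof. intros HM Hv; apply (norm_inf_le_iff M v _ HM Hv (norm_inf_ge0 M v)); apply Rle_refl. Qed.

Lemma fold_Rplus_acc (l : list R) (x : R) : fold_right Rplus x l = fold_right Rplus 0 l + x.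
Proof. induction l as [|y l IH]; cbn; [ring | rewrite IH; ring]. Qed.

Lemma fold_Rplus_seq_S (w : nat -> R) (n : nat) :
  fold_right Rplus 0 (map w (seq 1 (S n))) = fold_right Rplus 0 (map w (seq 1 n)) + w (S n).
Proof.
rewrite seq_S, map_app, fold_right_app; cbn [map fold_right]; rewrite fold_Rplus_acc; f_equal.
cbn; ring.
Qed.

(* Summation by parts turns the left side into a combination of the [u k] with nonnegative weights of total [B p]. *)
Lemma monotone_weighted_increments (B u : nat -> R) (beta : R) (p : nat) :
  0 <= B 1%nat -> (forall k, (1 <= k < p)%nat -> B k <= B (S k)) ->
  (1 <= p)%nat -> (forall k, (k < p)%nat -> Rabs (u k) <= beta) ->
  Rabs (B p * u p - fold_right Rplus 0 (map (fun k => B k * (u k - u (k - 1)%nat)) (seq 1 p)))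
    <= B p * beta.
Proof.
intros HB0 HB Hp Hu; induction p as [|p IH]; [lia|].
rewrite fold_Rplus_seq_S, Nat.sub_succ, Nat.sub_0_r.
specialize (Hu p (Nat.lt_succ_diag_r p)) as Hup.
set (s := fold_right _ _ _) in *.
destruct p as [|p].
(* With a single increment the newest value cancels and only [u 0] is left. *)
- unfold s; cbn; replace (_ - _) with (B 1%nat * u 0%nat) by ring.
  rewrite Rabs_mult, Rabs_pos_eq by exact HB0; apply Rmult_le_compat_l; assumption.
- specialize (HB (S p) ltac:(lia)) as HBp.
  (* The newest value cancels again; what remains is one new term of weight
     [B (S (S p)) - B (S p) >= 0] and the quantity of the induction hypothesis. *)
  replace (_ - _) with ((B (S (S p)) - B (S p)) * u (S p) + (B (S p) * u (S p) - s)) by ring.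
  apply Rle_trans with (1 := Rabs_triang _ _).
  assert (Rabs (B (S p) * u (S p) - s) <= B (S p) * beta).
  { apply IH; [|lia|]; intros; [apply HB | apply Hu]; lia. }
  assert (Rabs ((B (S (S p)) - B (S p)) * u (S p)) <= (B (S (S p)) - B (S p)) * beta).
  { rewrite Rabs_mult, Rabs_pos_eq by lra; apply Rmult_le_compat_l; lra. }
  lra.
Qed.

(** * The nonlinearity *)

Lemma fnl_odd (c : nonlin) (beta x : R) : nonlin_ok c beta -> - beta <= x <= beta -> fnl c (- x) = - fnl c x.
Proof.
destruct c as [|th thc]; cbn; [intros; ring|].
intros (Hth & Hthc & Hb0 & Hb1 & _) Hx.
replace (1 - - x) with (1 + x) by ring; replace (1 + - x) with (1 - x) by ring.
unfold Rdiv; rewrite !ln_mult, !ln_Rinv by (try apply Rinv_0_lt_compat; lra); ring.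
Qed.

Lemma nonlin_ok_pos (c : nonlin) (beta : R) : nonlin_ok c beta -> 0 < beta.
Proof. destruct c; cbn; intros; lra. Qed.

Lemma fnl_beta (c : nonlin) (beta : R) : nonlin_ok c beta -> fnl c beta = 0.
Proof. destruct c; cbn; [intros ->; ring | intros; tauto]. Qed.

Lemma ex_derive_fnl (c : nonlin) (beta x : R) :
  nonlin_ok c beta -> - beta <= x <= beta -> ex_derive (fnl c) x.
Proof.
destruct c as [|th thc]; intros H Hx; unfold fnl.
- auto_derive; exact I.
- destruct H as (Hth & Hthc & Hb0 & Hb1 & _).
  auto_derive; split; [lra|]; split; [|exact I].
  apply Rmult_lt_0_compat; [|apply Rinv_0_lt_compat]; lra.
Qed.

(** Since [kappa] bounds the derivative of [f], the function [f + kappa x] is nondecreasing on the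
    interval, and its value at [beta] is [kappa beta]. Oddness of [f] gives the lower bound. *)
Lemma stabilized_fnl_bound (c : nonlin) (beta kappa x : R) : nonlin_ok c beta ->
  (forall x, - beta <= x <= beta -> Rabs (Derive (fnl c) x) <= kappa) ->
  Rabs x <= beta -> Rabs (fnl c x + kappa * x) <= kappa * beta.
Proof.
intros Hc Hk Hx; assert (Hb := nonlin_ok_pos _ _ Hc); assert (Hfb := fnl_beta _ _ Hc).
assert (Hup : forall y, - beta <= y <= beta -> fnl c y + kappa * y <= kappa * beta).
{ intros y Hy.
  assert (H := increment_le (fun s => - kappa * s) (fnl c) (fun _ => - kappa) (Derive (fnl c)) y beta).
  assert (- kappa * beta - - kappa * y <= fnl c beta - fnl c y); [|lra].
  apply H.
  - lra.
  - intros; auto_derive; [exact I | ring].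
  - intros; apply Derive_correct; apply (ex_derive_fnl c beta); [exact Hc | lra].
  - intros z Hz; specialize (Hk z ltac:(lra)); apply Rabs_le_between in Hk; lra. }
apply Rabs_le_between in Hx; apply Rabs_le_between.
assert (H1 := Hup x Hx); assert (H2 := Hup (- x) ltac:(lra)).
rewrite (fnl_odd c beta x Hc Hx) in H2; lra.
Qed.

(** * Pointwise bounds for one step of the scheme *)

Lemma clamp_bound (beta x : R) : 0 <= beta -> Rabs (clamp beta x) <= beta.
Proof.
intros Hb; unfold clamp; apply Rabs_le_between; split; [|apply Rmin_r].
apply Rmin_glb; [apply Rmax_r | lra].
Qed.

Lemma gcomb_bound (a b beta : R) (v w : grid) (i j : Z) : 0 <= a -> 0 <= b -> a + b = 1 ->
  Rabs (v i j) <= beta -> Rabs (w i j) <= beta -> Rabs (gcomb a v b w i j) <= beta.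
Proof.
intros Ha Hb Hab Hv Hw; unfold gcomb.
apply Rabs_le_between in Hv; apply Rabs_le_between in Hw; apply Rabs_le_between.
split; nra.
Qed.

(** Off-diagonal part of the five-point Laplacian, kept apart because the diagonal part of the new
    values moves to the left side of the step. *)
Definition nbr_sum (v : grid) (i j : Z) : R :=
  v (i + 1)%Z j + v (i - 1)%Z j + v i (j + 1)%Z + v i (j - 1)%Z.

Lemma nbr_sum_bound (v : grid) (X : R) (i j : Z) :
  (forall i j, Rabs (v i j) <= X) -> Rabs (nbr_sum v i j) <= 4 * X.
Proof.
intros H; unfold nbr_sum.
assert (H1 := H (i + 1)%Z j); assert (H2 := H (i - 1)%Z j);
assert (H3 := H i (j + 1)%Z); assert (H4 := H i (j - 1)%Z).
apply Rabs_le_between in H1, H2, H3, H4; apply Rabs_le_between; lra.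
Qed.

Lemma lap_gcomb (h a b : R) (v w : grid) (i j : Z) :
  lap h (gcomb a v b w) i j
  = / h ^ 2 * (a * (nbr_sum v i j - 4 * v i j) + b * (nbr_sum w i j - 4 * w i j)).
Proof. unfold lap, gcomb, nbr_sum; ring. Qed.

Lemma Rabs_mult_le (a x X : R) : 0 <= a -> Rabs x <= X -> Rabs (a * x) <= a * X.
Proof. intros Ha Hx; rewrite Rabs_mult, (Rabs_pos_eq a) by exact Ha; apply Rmult_le_compat_l; assumption. Qed.

(* Moving the implicit terms to the left, [(B + m (1-s) (kappa W + 4 e)) x] is a sum of terms
   bounded separately; the coefficient of [y] stays nonnegative by the gap hypothesis. *)
Lemma pointwise_max_step (B Q S m e s kappa W beta X x y nx ny fv pv : R) :
  0 < m -> 0 <= e -> 0 <= s <= 1 -> 0 <= kappa -> 0 <= W ->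
  S = m * (e * ((1 - s) * (nx - 4 * x) + s * (ny - 4 * y)) + W * fv
           - kappa * W * ((1 - s) * x + s * y - pv)) ->
  Rabs (B * x - S - (B - Q) * y) <= Q * beta ->
  Rabs nx <= 4 * X -> Rabs ny <= 4 * beta -> Rabs y <= beta ->
  Rabs (fv + kappa * pv) <= kappa * beta ->
  s * m * (4 * e + kappa * W) <= B - Q ->
  0 <= B ->
  (B + m * (1 - s) * (kappa * W + 4 * e)) * Rabs x
    <= (B + m * (1 - s) * (kappa * W)) * beta + m * (1 - s) * e * 4 * X.
Proof.
intros Hm He Hs Hk HW HS HQ Hnx Hny Hy Hf Hgap HB.
assert (HkW : 0 <= kappa * W) by (apply Rmult_le_pos; assumption).
assert (Hms : 0 <= m * (1 - s)) by (apply Rmult_le_pos; lra).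
assert (Hms' : 0 <= m * s) by (apply Rmult_le_pos; lra).
assert (Hc : 0 <= B + m * (1 - s) * (kappa * W + 4 * e)).
{ assert (0 <= m * (1 - s) * (kappa * W + 4 * e)) by (apply Rmult_le_pos; lra); lra. }
rewrite <- (Rabs_pos_eq _ Hc) at 1; rewrite <- Rabs_mult.
assert (T1 := Rabs_mult_le (m * (1 - s) * e) nx _ (Rmult_le_pos _ _ Hms He) Hnx).
assert (T2 := Rabs_mult_le (m * s * e) ny _ (Rmult_le_pos _ _ Hms' He) Hny).
assert (T3 := Rabs_mult_le (m * W) _ _ (Rmult_le_pos _ _ (Rlt_le _ _ Hm) HW) Hf).
assert (T4 := Rabs_mult_le (B - Q - s * m * (4 * e + kappa * W)) y beta ltac:(lra) Hy).
(* The weights of [beta] add up to [Q + 4 m s e + m kappa W + (B - Q - s m (4 e + kappa W)) = B + m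
   (1 - s) kappa W]. *)
replace ((B + m * (1 - s) * (kappa * W + 4 * e)) * x) with
  ((B * x - S - (B - Q) * y) + (m * (1 - s) * e * nx + (m * s * e * ny
    + (m * W * (fv + kappa * pv) + (B - Q - s * m * (4 * e + kappa * W)) * y))))
  by (rewrite HS; ring).
apply Rabs_le_between in T1, T2, T3, T4, HQ; apply Rabs_le_between; lra.
Qed.

(** * The step size restriction *)

Lemma Rpower_opp_ge (tau X a : R) : 0 < a -> 0 < X -> 0 < tau -> tau <= Rpower X (/ a) ->
  / X <= Rpower tau (- a).
Proof.
intros Ha HX Htau Hle; rewrite Rpower_Ropp; apply Rinv_le_contravar; [apply Rpower_pos|].
apply Rle_trans with (Rpower (Rpower X (/ a)) a); [apply Rle_Rpower_l; lra|].
rewrite Rpower_mult, Rinv_l, Rpower_1; lra.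
Qed.

(* The factor [11/4 * (1 - alpha/2)] left over is at least 1. *)
Lemma step_size_gap (alpha m A tau : R) : 0 < alpha < 1 -> 0 < m -> 0 < A -> 0 < tau ->
  tau <= Rpower (4 / (11 * (1 - alpha / 2) * m * A * Gamma (2 - alpha))) (/ alpha) ->
  alpha / 2 * m * A <= alpha / 2 / Gamma (2 - alpha) * Rpower tau (- alpha).
Proof.
intros Ha Hm HA Htau Hle.
assert (HG : 0 < Gamma (2 - alpha)).
(* [Gamma_pos] covers only (0,1], so the recurrence supplies positivity at [2 - alpha]. *)
{ replace (2 - alpha) with (1 - alpha + 1) by ring; rewrite Gamma_succ by lra.
  apply Rmult_lt_0_compat; [lra | apply Gamma_pos; lra]. }
assert (HmA : 0 < m * A) by (apply Rmult_lt_0_compat; assumption).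
assert (HD : 0 < 11 * (1 - alpha / 2) * m * A * Gamma (2 - alpha)) by (repeat apply Rmult_lt_0_compat; lra).
apply Rpower_opp_ge in Hle; [| lra | apply Rdiv_lt_0_compat; lra | exact Htau].
apply Rle_trans with (alpha / 2 / Gamma (2 - alpha) * / (4 / (11 * (1 - alpha / 2) * m * A * Gamma (2 - alpha)))).
- replace (alpha / 2 / Gamma (2 - alpha) * / (4 / (11 * (1 - alpha / 2) * m * A * Gamma (2 - alpha))))
    with (alpha / 2 * m * A * (11 / 4 * (1 - alpha / 2))) by (field; repeat split; lra).
  rewrite <- (Rmult_1_r (alpha / 2 * m * A)) at 1; apply Rmult_le_compat_l; [|lra].
  rewrite Rmult_assoc; apply Rmult_le_pos; lra.
- apply Rmult_le_compat_l; [|exact Hle].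
  left; apply Rdiv_lt_0_compat; lra.
Qed.

(** With [Q] the coefficient before the last, all that the discrete derivative contains besides the
    new value is [(B - Q) phi^p] plus a combination of values before level [p] with nonnegative
    weights of total [Q]. The bound on [Q] is what the gap estimate asks for. *)
Lemma Dalpha_history_bound (alpha : R) (t : nat -> R) (phi : nat -> grid) (beta : R) (p : nat) (i j : Z) :
  0 < alpha < 1 -> (forall k, (k < S p)%nat -> t k < t (S k)) ->
  (forall k, (2 <= k <= S p)%nat -> ratio t k >= 4 / 7) ->
  (forall k, (k <= p)%nat -> Rabs (phi k i j) <= beta) ->
  exists Q, 0 <= Q <= kern alpha (tsig alpha t (S p)) (t p) /\
    Rabs (Bcoef alpha t (S p) (S p) * phi (S p) i j - Dalpha alpha t phi (S p) i j
          - (Bcoef alpha t (S p) (S p) - Q) * phi p i j) <= Q * beta.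
Proof.
intros Ha Ht Hr Hphi; pose (B := Bcoef alpha t (S p)).
assert (Hkp := fun s => kern_pos alpha (tsig alpha t (S p)) Ha s).
assert (HB := Bcoef_bounds alpha t (S p) Ha Ht Hr).
unfold Dalpha; rewrite fold_Rplus_seq_S, Nat.sub_succ, Nat.sub_0_r.
destruct p as [|p].
(* At the first level no earlier coefficient exists; with [Q = 0] the remainder vanishes
   identically. *)
- exists 0; split; [split; [lra | left; apply Hkp]|].
  cbn [seq map fold_right]; rewrite Rmult_0_l; right.
  match goal with |- Rabs ?x = 0 => replace x with 0 by ring end; apply Rabs_R0.
- exists (B (S p)); split.
  + specialize (HB p ltac:(lia)); split; [left; apply Rlt_le_trans with (2 := proj1 HB); apply Hkp | apply HB].
  + assert (H := monotone_weighted_increments B (fun k => phi k i j) beta (S p)).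
    match goal with |- Rabs ?x <= _ => replace x with
      (B (S p) * phi (S p) i j - fold_right Rplus 0
         (map (fun k => B k * (phi k i j - phi (k - 1)%nat i j)) (seq 1 (S p))))
      by (unfold B; ring) end.
    apply H.
    * left; apply Rlt_le_trans with (2 := proj1 (HB 0%nat ltac:(lia))); apply Hkp.
    * intros k Hk; destruct k as [|k]; [lia|].
      apply Rle_trans with (1 := proj2 (HB k ltac:(lia))); apply HB; lia.
    * lia.
    * intros k Hk; apply Hphi; lia.
Qed.

(** * Induction over the time levels *)

Theorem mainTheorem10
  (c : nonlin) (beta : R) (L m eps alpha kappa K1 K2 : R) (M N : nat) (V : R -> R)
  (t : nat -> R) (phi0 : grid) (R0 : R)
  (phi : nat -> grid) (Rs : nat -> R) (phihat1 : grid) :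
  nonlin_ok c beta ->
  0 < L -> (1 <= M)%nat -> 0 < m -> 0 < eps -> 0 < alpha < 1 -> 0 <= kappa ->
  hypA1 V K1 -> hypA2 V K2 -> hypA3 V ->
  t 0%nat = 0 -> (forall k, (1 <= k <= N)%nat -> t (k - 1)%nat < t k) ->
  let h := L / INR M in
  let vs := alpha / 2 in
  (* hypotheses of the theorem *)
  (forall k, (2 <= k <= N)%nat -> ratio t k >= 4 / 7) ->
  (forall x, - beta <= x <= beta -> Rabs (Derive (fnl c) x) <= kappa) ->
  in_Vh M phi0 -> norm_inf M phi0 <= beta ->
  (1 <= N)%nat ->
  tau t 1 <= Rmin
     (Rpower (4 / (11 * vs * m * (kappa + 4 * eps ^ 2 / h ^ 2) * Gamma (2 - alpha))) (/ alpha))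
     (Rpower (4 / (11 * kappa * (1 - vs) * m * Gamma (2 - alpha))) (/ alpha)) ->
  (forall n, (1 <= n <= N)%nat ->
     tau t n <= Rpower (4 / (11 * (1 - vs) * m * (4 * eps ^ 2 / h ^ 2 + kappa * K2) * Gamma (2 - alpha))) (/ alpha)) ->
  (* the balanced L2-1_sigma-sESAV scheme *)
  phi 0%nat = phi0 -> Rs 0%nat = R0 ->
  in_Vh M phihat1 -> norm_inf M phihat1 <= beta ->
  (forall i j,
     acoef alpha t 1 1 * (phihat1 i j - phi0 i j) =
     m * (eps ^ 2 * lap h (gcomb (1 - vs) phihat1 vs phi0) i j
          + fnl c ((1 - vs) * phihat1 i j + vs * phi0 i j))) ->
  (forall n, (1 <= n <= N)%nat ->
     let ph := gcomb (1 - vs) (phihat beta t phi phihat1 n) vs (phi (n - 1)%nat) in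
     let p := gcomb (1 - vs) (phi n) vs (phi (n - 1)%nat) in
     let Vn := V (gh c M h ph (Rs (n - 1)%nat)) in
     in_Vh M (phi n) /\
     (forall i j,
        Dalpha alpha t phi n i j =
        m * (eps ^ 2 * lap h p i j + Vn * fnl c (ph i j) - kappa * Vn * (p i j - ph i j))) /\
     (Rs n - Rs (n - 1)%nat) / tau t n =
        Vn * ip M h (fun i j => - fnl c (ph i j) + kappa * (p i j - ph i j))
                    (fun i j => (phi n i j - phi (n - 1)%nat i j) / tau t n)) ->
  forall n, (1 <= n <= N)%nat -> norm_inf M (phi n) <= beta.
Proof.
intros Hc HL HM Hm Heps Ha Hkap _ [HK2 HV] _ Ht0 Ht h vs Hratio Hkf Hper0 Hphi0 HN _ Hstep
  Hp0 HR0 Hper1 Hhat1 _ Hscheme.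
assert (Hbeta := nonlin_ok_pos _ _ Hc).
assert (Hh : 0 < h) by (apply Rdiv_lt_0_compat; [exact HL | apply lt_0_INR; lia]).
pose (e := eps ^ 2 / h ^ 2).
assert (He : 0 < e) by (apply Rdiv_lt_0_compat; apply pow_lt; assumption).
(* Every step involves the whole history, so the induction carries the bound for all levels up to
   [n]. *)
assert (Hmain : forall n, (n <= N)%nat -> forall k, (k <= n)%nat -> forall i j, Rabs (phi k i j) <= beta).
{ induction n as [|p IH]; intros Hn k Hk.
  { replace k with 0%nat by lia; rewrite Hp0; apply (norm_inf_le_iff M); auto; lra. }
  destruct (Nat.eq_dec k (S p)) as [->|Hne]; [clear Hk | apply IH; lia].
  specialize (IH ltac:(lia)).
  destruct (Hscheme (S p) ltac:(lia)) as (Hper & Heq & _).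
  rewrite Nat.sub_succ, Nat.sub_0_r in Heq.
  set (ph := gcomb (1 - vs) (phihat beta t phi phihat1 (S p)) vs (phi p)) in *.
  set (W := V _) in Heq.
  assert (HW := HV _ : 0 <= W <= K2).
  (* A convex combination of the previous level with the prediction, which is bounded by truncation,
     or by the assumption on [phihat1] at the first level. *)
  assert (Hph : forall i j, Rabs (ph i j) <= beta).
  { intros i j; apply gcomb_bound; [unfold vs; lra.. | | apply IH; lia].
    unfold phihat; destruct p; cbn [Nat.eqb]; [|apply clamp_bound; lra].
    apply (norm_inf_le_iff M); auto; lra. }
  assert (Hts : forall k, (k < S p)%nat -> t k < t (S k)).
  { intros k Hk; specialize (Ht (S k) ltac:(lia)); rewrite Nat.sub_succ, Nat.sub_0_r in Ht; exact Ht. }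
  assert (Hrs : forall k, (2 <= k <= S p)%nat -> ratio t k >= 4 / 7) by (intros; apply Hratio; lia).
  (* The step size restriction is stated with [K2]; as [W <= K2], its constant dominates the one
     that the actual value [W] requires. *)
  pose (A := 4 * eps ^ 2 / h ^ 2 + kappa * K2).
  assert (HA : 0 < A /\ 4 * e + kappa * W <= A).
  { assert (0 <= kappa * W) by (apply Rmult_le_pos; lra).
    assert (kappa * W <= kappa * K2) by (apply Rmult_le_compat_l; lra).
    unfold A; replace (4 * eps ^ 2 / h ^ 2) with (4 * e) by (unfold e; field; lra); lra. }
  assert (Htau : 0 < tau t (S p)) by (apply (tau_S_pos t (S p) Hts); lia).
  assert (Hgap := step_size_gap alpha m A (tau t (S p)) Ha Hm (proj1 HA) Htau (Hstep (S p) ltac:(lia))).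
  pose (B := Bcoef alpha t (S p) (S p)).
  assert (HBgap : forall Q, Q <= kern alpha (tsig alpha t (S p)) (t p) -> vs * m * A <= B - Q).
  { intros Q HQ; apply Rle_trans with (1 := Hgap); apply (Bcoef_last_gap alpha t (S p) Ha Hts Hrs p); auto. }
  assert (HvmA : 0 < vs * m * A) by (unfold vs; repeat apply Rmult_lt_0_compat; lra).
  assert (HB : 0 < B).
  { specialize (HBgap 0 ltac:(left; apply kern_pos; exact Ha)); lra. }
  assert (HkW : 0 <= m * (1 - vs) * (kappa * W)) by (repeat apply Rmult_le_pos; unfold vs; lra).
  assert (Hme : 0 < m * (1 - vs) * e) by (apply Rmult_lt_0_compat; [apply Rmult_lt_0_compat; unfold vs|]; lra).
  pose (X := norm_inf M (phi (S p))).
  (* The implicit neighbours are bounded only by [X] itself, so [X] occurs on both sides: [D] is the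
     total weight of the terms bounded by [beta], and [k] that of the four new neighbours. *)
  pose (D := B + m * (1 - vs) * (kappa * W)); pose (k := 4 * (m * (1 - vs) * e)).
  assert (HX : X <= (D * beta + k * X) / (D + k)).
  { assert (HX0 := norm_inf_ge0 M (phi (S p))); fold X in HX0.
    apply norm_inf_le_iff; auto.
    - apply Rmult_le_pos; [|left; apply Rinv_0_lt_compat; unfold D, k; lra].
      apply Rplus_le_le_0_compat; apply Rmult_le_pos; unfold D, k; lra.
    - intros i j; apply (Rmult_le_reg_l (D + k)); [unfold D, k; lra|].
      replace ((D + k) * ((D * beta + k * X) / (D + k))) with (D * beta + k * X) by (field; unfold D, k; lra).
      destruct (Dalpha_history_bound alpha t phi beta p i j Ha Hts Hrs) as (Q & [HQ0 HQg] & HQ).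
      { intros q Hq; apply IH; exact Hq. }
      assert (H := pointwise_max_step B Q (Dalpha alpha t phi (S p) i j) m e vs kappa W beta X
        (phi (S p) i j) (phi p i j) (nbr_sum (phi (S p)) i j) (nbr_sum (phi p) i j)
        (fnl c (ph i j)) (ph i j)).
      replace (D + k) with (B + m * (1 - vs) * (kappa * W + 4 * e)) by (unfold D, k; ring).
      replace (D * beta + k * X) with
        ((B + m * (1 - vs) * (kappa * W)) * beta + m * (1 - vs) * e * 4 * X) by (unfold D, k; ring).
      apply H; try lra.
      + unfold vs; lra.
      + rewrite Heq, lap_gcomb; unfold gcomb, e; field; lra.
      + exact HQ.
      + apply nbr_sum_bound; intros; apply norm_inf_bound; auto.
      + apply nbr_sum_bound; intros; apply IH; lia.
      + apply IH; lia.
      + apply (stabilized_fnl_bound c beta); auto.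
      + apply Rle_trans with (2 := HBgap Q HQg).
        apply Rmult_le_compat_l; [apply Rmult_le_pos; unfold vs; lra | apply HA]. }
  intros i j; apply Rle_trans with X; [apply norm_inf_bound; auto|].
  (* Cancelling [k X] leaves [D X <= D beta] with [D > 0]. *)
  assert (HD : 0 < D) by (unfold D; lra); assert (Hk : 0 < k) by (unfold k; lra).
  apply (Rmult_le_compat_r (D + k)) in HX; [|lra].
  unfold Rdiv in HX; rewrite Rmult_assoc, Rinv_l in HX by lra.
  apply (Rmult_le_reg_l D); lra. }
intros n Hn; destruct (Hscheme n Hn) as (Hper & _).
apply norm_inf_le_iff; [exact HM | exact Hper | lra |].
apply (Hmain n); lia.
Qed.
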